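(* Let $X$ be a connected Alexandroff space, let $x_0\in X$ and let $H$ be a normal subgroup of $\pi_1(X,x_0)$. Then there exist a group $G$ and a functor $\mathcal{F}\colon X\to G$ such that the canonical projection $p\colon\mathcal{F}\downarrow *\to X$ is the connected regular covering of $X$ that corresponds to the subgroup $H$; that is, $\mathcal{F}\downarrow *$ is connected, $p$ is a regular covering map, and $p_*(\pi_1(\mathcal{F}\downarrow *,\tilde{x}_0))=H$ for $\tilde{x}_0\in p^{-1}(x_0)$.
   Context: An Alexandroff space is a topological space in which arbitrary intersections of open sets are open. For $x\in X$, $U_x$ is the intersection of all open sets containing $x$; the specialization preorder is $x\le y$ iff $x\in U_y$. This identifies Alexandroff spaces with preordered sets (open sets = lower sets). A preordered set is regarded as a small category with a unique arrow $x\to y$ iff $x\le y$. A group $G$ is regarded as a category with a unique object $*$. For a functor $\mathcal{F}\colon X\to G$, the comma category $\mathcal{F}\downarrow *$ (where $*$ also denotes the functor from the terminal category to $G$) has object set $X\times G$, and there is an arrow $(x,g)\to(x',g')$, which is then unique, iff $x\le x'$ and $g=g'\mathcal{F}(x\le x')$; so it is a preordered set, regarded as an Alexandroff space, and $p(x,g)=x$. $\pi_1(X,x_0)$ is the automorphism group of $x_0$ in the fundamental groupoid of $X$, with $[\beta][\alpha]=[\alpha*\beta]$ ($\alpha$ followed by $\beta$). A covering map $p$ is regular if the image under $p_*$ of the fundamental group of the total space, at each basepoint, is a normal subgroup of the fundamental group of $X$. *)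

(* Defs.v *)
From HB Require Import structures.
From mathcomp Require Import all_boot all_order all_algebra generic_quotient.
From mathcomp Require Import all_classical all_reals topology normedtype.
From mathcomp Require Import homotopy.
From mathcomp Require Import ring lra.
Import Order.TTheory GRing.Theory Num.Theory.
Import numFieldNormedType.Exports.
Set SsrOldRewriteGoalsOrder.
Set Implicit Arguments.
Unset Strict Implicit.
Unset Printing Implicit Defensive.
Local Open Scope classical_set_scope.
Local Open Scope ring_scope.
Local Open Scope quotient_scope.

Definition alexandroff (X : topologicalType) : Prop :=
  forall A : set (set X), A `<=` open -> open (\bigcap_(U in A) U).

Definition min_open (X : topologicalType) (x : X) : set X :=
  \bigcap_(U in [set U : set X | open U /\ U x]) U.

Fact spec_display : Order.disp_t. Proof. exact: Order.Disp tt tt. Qed.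

(* A copy of X, so that the specialization preorder does not clash with any
   order X may carry. *)
Definition spec (X : topologicalType) : Type := X.

Section Spec.
Context (X : topologicalType).

HB.instance Definition _ := Choice.on (spec X).

Let spec_le (x y : spec X) : bool := `[< min_open (y : X) x >].

Let spec_le_refl : reflexive spec_le.
Proof. by move=> x; apply/asboolP => U []. Qed.

Let spec_le_trans : transitive spec_le.
Proof.
move=> y x z /asboolP xy /asboolP yz; apply/asboolP => U [oU Uz].
by apply: xy; split=> //; exact: yz.
Qed.

HB.instance Definition _ :=
  Order.Le_isPreorder.Build spec_display (spec X) spec_le_refl spec_le_trans.

Lemma spec_leP (x y : spec X) :
  reflect (min_open (y : X) x) (x <= y)%O.
Proof. exact: asboolP. Qed.

End Spec.

(* A copy of P, so that the lower-set topology does not clash with any topology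
   P may carry. *)
Definition lower_space (d : Order.disp_t) (P : preorderType d) : Type := P.

Section LowerSpace.
Context (d : Order.disp_t) (P : preorderType d).

HB.instance Definition _ := Choice.on (lower_space P).

Let lower (U : set (lower_space P)) : Prop :=
  forall x y : P, (x <= y)%O -> U y -> U x.

Let lowerT : lower setT. Proof. by []. Qed.

Let lowerI : setI_closed lower.
Proof. by move=> U V lU lV x y xy [/(lU _ _ xy) ? /(lV _ _ xy)]. Qed.

Let lower_bigU (I : Type) (f : I -> set (lower_space P)) :
  (forall i, lower (f i)) -> lower (\bigcup_i f i).
Proof. by move=> lf x y xy [i _ /(lf i _ _ xy) ?]; exists i. Qed.

HB.instance Definition _ :=
  isOpenTopological.Build (lower_space P) lowerT lowerI lower_bigU.

Lemma open_lowerE (U : set (lower_space P)) :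
  open U = (forall x y : P, (x <= y)%O -> U y -> U x).
Proof. by []. Qed.

End LowerSpace.

Lemma alexandroff_lower_space (d : Order.disp_t) (P : preorderType d) :
  alexandroff (lower_space P).
Proof.
move=> A Ao; rewrite open_lowerE => x y xy Uy V AV.
by have := Ao V AV; rewrite open_lowerE => /(_ _ _ xy); apply; apply: Uy.
Qed.

Lemma open_specE (X : topologicalType) (U : set X) : alexandroff X ->
  @open X U <-> @open (lower_space (spec X)) U.
Proof.
move=> aX; rewrite open_lowerE; split=> [oU x y /spec_leP xy Uy|lU].
  by apply: xy.
have -> : U = \bigcup_(x in U) min_open x.
  apply/seteqP; split=> x; first by move=> Ux; exists x => // V [].
  by move=> [y Uy xy]; apply: (lU x y) => //; apply/spec_leP.
by apply: bigcup_open => x _; apply: aX => V [].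
Qed.

(* A group is a category with one object, in which the composite of f followed
   by g is the product g * f. *)
Record group_functor (d : Order.disp_t) (P : preorderType d) (G : groupType) :=
  GroupFunctor {
    farrow :> forall x y : P, (x <= y)%O -> G;
    farrow_id : forall (x : P) (xx : (x <= x)%O), farrow xx = 1%g;
    farrow_comp : forall (x y z : P) (xy : (x <= y)%O) (yz : (y <= z)%O)
      (xz : (x <= z)%O), farrow xz = (farrow yz * farrow xy)%g
  }.

Fact comma_display : Order.disp_t. Proof. exact: Order.Disp tt tt. Qed.

(* The pair (x, g) is the object x together with the arrow g : F x -> *. *)
Definition comma (d : Order.disp_t) (P : preorderType d) (G : groupType)
  (F : group_functor P G) : Type := (P * G)%type.

Section Comma.
Context (d : Order.disp_t) (P : preorderType d) (G : groupType).
Context (F : group_functor P G).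

HB.instance Definition _ := Choice.on (comma F).

Let comma_le (u v : comma F) : bool :=
  `[< exists uv : (u.1 <= v.1)%O, u.2 = (v.2 * F _ _ uv)%g >].

Let comma_le_refl : reflexive comma_le.
Proof.
move=> u; apply/asboolP; exists (lexx u.1).
by rewrite farrow_id mulg1.
Qed.

Let comma_le_trans : transitive comma_le.
Proof.
move=> v u w /asboolP[uv Euv] /asboolP[vw Evw]; apply/asboolP.
exists (le_trans uv vw).
by rewrite Euv Evw -mulgA (farrow_comp F uv vw).
Qed.

HB.instance Definition _ :=
  Order.Le_isPreorder.Build comma_display (comma F) comma_le_refl comma_le_trans.

Lemma comma_leP (u v : comma F) :
  reflect (exists uv : (u.1 <= v.1)%O, u.2 = (v.2 * F _ _ uv)%g) (u <= v)%O.
Proof. exact: asboolP. Qed.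

End Comma.

Section CommaProj.
Context (X : topologicalType) (G : groupType) (F : group_functor (spec X) G).

Definition comma_proj (u : lower_space (comma F)) : X := u.1.

Let comma_proj_continuous : continuous comma_proj.
Proof.
apply/continuousP => U oU; rewrite open_lowerE => u v /comma_leP[/spec_leP uv _] Uv.
exact: uv.
Qed.

HB.instance Definition _ :=
  isContinuous.Build (lower_space (comma F)) X comma_proj comma_proj_continuous.

End CommaProj.

Arguments comma_proj {X G} F u.

Definition unitI (R : realType) : Type := [set t : R | 0 <= t <= 1].

Section UnitInterval.
Context (R : realType).

HB.instance Definition _ := Topological.on (unitI R).

Definition ival (t : unitI R) : R := \val t.

Let clamp_subproof (t : R) :
  Num.max 0 (Num.min 1 t) \in [set t : R | 0 <= t <= 1].
Proof. by rewrite inE /= le_max lexx /= ge_max ler01 ge_min lexx. Qed.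

Definition clamp (t : R) : unitI R := SigSub (clamp_subproof t).

Lemma ival_ge0 (t : unitI R) : 0 <= ival t.
Proof. by have /set_mem/andP[] := valP t. Qed.

Lemma ival_le1 (t : unitI R) : ival t <= 1.
Proof. by have /set_mem/andP[] := valP t. Qed.

Lemma ival_inj : injective ival.
Proof. exact: val_inj. Qed.

Lemma clampK (t : R) : 0 <= t <= 1 -> ival (clamp t) = t.
Proof. by move=> /andP[t0 t1]; rewrite /ival/= (min_idPr t1) (max_idPr t0). Qed.

Lemma ivalK : cancel ival clamp.
Proof.
by move=> t; apply: ival_inj; rewrite clampK // ival_ge0 ival_le1.
Qed.

Lemma clamp0 (t : R) : t <= 0 -> clamp t = clamp 0.
Proof.
move=> t0; apply: ival_inj; rewrite /ival/=.
by rewrite (min_idPr (le_trans t0 ler01)) (min_idPr ler01) (max_idPl t0) maxxx.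
Qed.

Lemma clamp1 (t : R) : 1 <= t -> clamp t = clamp 1.
Proof. by move=> t1; apply: ival_inj; rewrite /ival/= (min_idPl t1) minxx. Qed.

Let clamp01_neq : clamp 0 != clamp 1.
Proof.
apply/eqP => /(congr1 ival); rewrite !clampK ?lexx ?ler01 //.
by move/eqP; rewrite eq_sym oner_eq0.
Qed.

HB.instance Definition _ := isBiPointed.Build (unitI R) clamp01_neq.

Lemma zeroE : @zero (unitI R) = clamp 0. Proof. by []. Qed.
Lemma oneE : @one (unitI R) = clamp 1. Proof. by []. Qed.

Lemma ival0 : ival zero = 0.
Proof. by rewrite zeroE clampK // lexx ler01. Qed.

Lemma ival1 : ival one = 1.
Proof. by rewrite oneE clampK // lexx ler01. Qed.

Lemma ival_continuous : continuous ival.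
Proof. exact: initial_continuous. Qed.

Lemma clamp_continuous : continuous clamp.
Proof.
apply: (@continuous_comp_initial _ R R set_val clamp).
move=> x; apply: continuous_max; first exact: cvg_cst.
by apply: continuous_min; [exact: cvg_cst | exact: cvg_id].
Qed.

End UnitInterval.

Section Homotopy.
Context (R : realType) (X : topologicalType).
Local Notation I := (unitI R).
Implicit Types x y z : X.

(* Homotopy relative to the endpoints; the first variable is the homotopy
   parameter. *)
Definition homotopic x y (a b : {path I from x to y}) : Prop :=
  exists h : I * I -> X, [/\ continuous h,
    (forall t, h (zero, t) = a t), (forall t, h (one, t) = b t),
    (forall s, h (s, zero) = x) & (forall s, h (s, one) = y)].

Let cts_pair (T U V : topologicalType) (f : T -> U) (g : T -> V) :
  continuous f -> continuous g -> continuous (fun t => (f t, g t)).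
Proof. by move=> cf cg t; apply: cvg_pair; [exact: cf|exact: cg]. Qed.

Let cts_comp (T U V : topologicalType) (f : T -> U) (g : U -> V) :
  continuous f -> continuous g -> continuous (fun t => g (f t)).
Proof. by move=> cf cg t; apply: continuous_comp; [exact: cf|exact: cg]. Qed.

Let cts_cst (T U : topologicalType) (y : U) : continuous (fun _ : T => y).
Proof. by move=> t; exact: cvg_cst. Qed.

Let cts_D (T : topologicalType) (f g : T -> R) :
  continuous f -> continuous g -> continuous (fun t => f t + g t).
Proof. by move=> cf cg t; apply: cvgD; [exact: cf|exact: cg]. Qed.

Let cts_B (T : topologicalType) (f g : T -> R) :
  continuous f -> continuous g -> continuous (fun t => f t - g t).
Proof. by move=> cf cg t; apply: cvgB; [exact: cf|exact: cg]. Qed.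

Let cts_M (T : topologicalType) (f g : T -> R) :
  continuous f -> continuous g -> continuous (fun t => f t * g t).
Proof. by move=> cf cg t; apply: cvgM; [exact: cf|exact: cg]. Qed.

Let cts_min (T : topologicalType) (f g : T -> R) :
  continuous f -> continuous g -> continuous (fun t => Num.min (f t) (g t)).
Proof. by move=> cf cg t; apply: continuous_min; [exact: cf|exact: cg]. Qed.

Let cts_fst (T U : topologicalType) : continuous (@fst T U).
Proof. by move=> u; exact: cvg_fst. Qed.

Let cts_snd (T U : topologicalType) : continuous (@snd T U).
Proof. by move=> u; exact: cvg_snd. Qed.

Lemma pasting (T : topologicalType) (h : T -> R) (c : R) (f g : T -> X) :
  continuous h -> continuous f -> continuous g ->
  (forall t, h t = c -> f t = g t) ->
  continuous (fun t => if h t <= c then f t else g t).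
Proof.
move=> ch cf cg fg t U; rewrite /= nbhs_simpl /=.
have [tc fU|ct gU|tc fU] := ltgtP (h t) c.
- have near_lt : nbhs t [set u | h u < c] by exact: (cvgr_lt _ (ch t)).
  have {}fU : nbhs t (f @^-1` U) := cf t _ fU.
  by apply: (filterS _ (filterI near_lt fU)) => u [/ltW uc fu] /=; rewrite uc.
- have near_gt : nbhs t [set u | c < h u] by exact: (cvgr_gt _ (ch t)).
  have {}gU : nbhs t (g @^-1` U) := cg t _ gU.
  by apply: (filterS _ (filterI near_gt gU)) => u [cu gu] /=; rewrite leNgt cu.
- have gU : nbhs t (g @^-1` U) by apply: cg; rewrite -fg.
  have {}fU : nbhs t (f @^-1` U) := cf t _ fU.
  by apply: (filterS _ (filterI fU gU)) => u [fu gu] /=; case: ifP.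
Qed.

Lemma homotopic_reparam x y (a b : {path I from x to y})
    (c : R -> X) (f g : I -> R) :
  continuous c -> continuous f -> continuous g ->
  f zero = g zero -> f one = g one ->
  (forall t, a t = c (f t)) -> (forall t, b t = c (g t)) -> homotopic a b.
Proof.
move=> cc cf cg fg0 fg1 af bg.
exists (fun u => c ((1 - ival u.1) * f u.2 + ival u.1 * g u.2)); split.
- have ci : continuous (fun u : I * I => ival u.1).
    by apply: cts_comp; [exact: cts_fst|exact: ival_continuous].
  have cf2 : continuous (fun u : I * I => f u.2).
    by apply: cts_comp; [exact: cts_snd|exact: cf].
  have cg2 : continuous (fun u : I * I => g u.2).
    by apply: cts_comp; [exact: cts_snd|exact: cg].
  apply: cts_comp cc.
  have c1 : continuous (fun u : I * I => 1 - ival u.1).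
    by apply: cts_B => //; exact: cts_cst.
  by apply: cts_D; apply: cts_M.
- by move=> t; rewrite ival0 subr0 mul1r mul0r addr0.
- by move=> t; rewrite ival1 subrr mul0r add0r mul1r.
- by move=> s; rewrite fg0 -mulrDl subrK mul1r -fg0 -af path_zero.
- by move=> s; rewrite fg1 -mulrDl subrK mul1r -fg1 -af path_one.
Qed.

Lemma homotopic_refl x y (a : {path I from x to y}) : homotopic a a.
Proof.
exists (fun u => a u.2); split=> //.
- by apply: cts_comp; [exact: cts_snd|exact: cts_fun].
- by move=> s; exact: path_zero.
- by move=> s; exact: path_one.
Qed.

Let rev_fun (t : I) : I := clamp (1 - ival t).

Let rev_continuous : continuous rev_fun.
Proof.
apply: (@cts_comp _ _ _ (fun t : I => 1 - ival t)); last exact: clamp_continuous.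
by apply: cts_B; [exact: cts_cst|exact: ival_continuous].
Qed.

Let rev0 : rev_fun zero = one. Proof. by rewrite /rev_fun ival0 subr0. Qed.
Let rev1 : rev_fun one = zero. Proof. by rewrite /rev_fun ival1 subrr. Qed.

Lemma homotopic_sym x y (a b : {path I from x to y}) :
  homotopic a b -> homotopic b a.
Proof.
move=> [h [ch h0 h1 hx hy]]; exists (fun u => h (rev_fun u.1, u.2)); split=> //.
- apply: cts_comp ch; apply: cts_pair (@cts_snd _ _).
    by apply: cts_comp; [exact: cts_fst|exact: rev_continuous].
- by move=> t; rewrite rev0.
- by move=> t; rewrite rev1.
Qed.

Let double (t : I) : I := clamp (2 * ival t).
Let double1 (t : I) : I := clamp (2 * ival t - 1).

Let double_continuous : continuous double.
Proof.
apply: (@cts_comp _ _ _ (fun t : I => 2 * ival t)); last exact: clamp_continuous.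
by apply: cts_M; [exact: cts_cst|exact: ival_continuous].
Qed.

Let double1_continuous : continuous double1.
Proof.
apply: (@cts_comp _ _ _ (fun t : I => 2 * ival t - 1)); last exact: clamp_continuous.
apply: cts_B; last exact: cts_cst.
by apply: cts_M; [exact: cts_cst|exact: ival_continuous].
Qed.

Let half_le0 : (ival (@zero I) <= 2^-1 :> R) = true.
Proof. by rewrite ival0 invr_ge0 ler0n. Qed.
Let half_le1 : (ival (@one I) <= 2^-1 :> R) = false.
Proof. by rewrite ival1; apply/negbTE; rewrite -ltNge; lra. Qed.
Let double_zero : double zero = zero.
Proof. by rewrite /double ival0 mulr0. Qed.
Let double1_one : double1 one = one.
Proof. by rewrite /double1 ival1 mulr1 oneE; congr (clamp _); ring. Qed.
Let double_half t : ival t = 2^-1 -> double t = one.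
Proof. by rewrite /double oneE => ->; rewrite mulfV ?pnatr_eq0. Qed.
Let double1_half t : ival t = 2^-1 -> double1 t = zero.
Proof. by rewrite /double1 zeroE => ->; rewrite mulfV ?pnatr_eq0// subrr. Qed.

Section Concat.
Context (x y z : X) (a : {path I from x to y}) (b : {path I from y to z}).

Definition concat_fun (t : I) : X :=
  if ival t <= 2^-1 then a (clamp (2 * ival t)) else b (clamp (2 * ival t - 1)).

Let concat_continuous : continuous concat_fun.
Proof.
apply: pasting.
- exact: ival_continuous.
- exact: cts_comp double_continuous (@cts_fun _ _ a).
- exact: cts_comp double1_continuous (@cts_fun _ _ b).
- move=> t t2; rewrite -/(double t) -/(double1 t).
  by rewrite double_half// double1_half// path_one path_zero.
Qed.

Let concat_zero : concat_fun zero = x.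
Proof. by rewrite /concat_fun half_le0 -/(double _) double_zero path_zero. Qed.

Let concat_one : concat_fun one = z.
Proof. by rewrite /concat_fun half_le1 -/(double1 _) double1_one path_one. Qed.

(* a followed by b *)
Definition concat : {path I from x to z} :=
  mk_path concat_continuous concat_zero concat_one.

End Concat.

Section ReversePath.
Context (x y : X) (a : {path I from x to y}).

Definition reverse_fun (t : I) : X := a (clamp (1 - ival t)).

Let reverse_continuous : continuous reverse_fun.
Proof.
exact: cts_comp rev_continuous (@cts_fun _ _ a).
Qed.

Let reverse_zero : reverse_fun zero = y.
Proof. by rewrite /reverse_fun -/(rev_fun _) rev0 path_one. Qed.

Let reverse_one : reverse_fun one = x.
Proof. by rewrite /reverse_fun -/(rev_fun _) rev1 path_zero. Qed.

Definition reverse : {path I from y to x} :=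
  mk_path reverse_continuous reverse_zero reverse_one.

End ReversePath.

Definition const_path x : {path I from x to x} := cst x.

Lemma homotopic_trans x y (b a c : {path I from x to y}) :
  homotopic a b -> homotopic b c -> homotopic a c.
Proof.
move=> [h [ch h0 h1 hx hy]] [k [ck k0 k1 kx ky]].
exists (fun u : I * I =>
  if ival u.1 <= 2^-1 then h (double u.1, u.2) else k (double1 u.1, u.2)); split.
- apply: pasting.
  + by apply: cts_comp; [exact: cts_fst|exact: ival_continuous].
  + apply: cts_comp ch; apply: cts_pair (@cts_snd _ _).
    by apply: cts_comp; [exact: cts_fst|exact: double_continuous].
  + apply: cts_comp ck; apply: cts_pair (@cts_snd _ _).
    by apply: cts_comp; [exact: cts_fst|exact: double1_continuous].
  + by move=> u u2; rewrite double_half// double1_half// h1 k0.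
- by move=> t; rewrite half_le0 double_zero.
- by move=> t; rewrite half_le1 double1_one.
- by move=> s; case: ifP.
- by move=> s; case: ifP.
Qed.

Lemma homotopic_concat x y z (a a' : {path I from x to y})
    (b b' : {path I from y to z}) :
  homotopic a a' -> homotopic b b' -> homotopic (concat a b) (concat a' b').
Proof.
move=> [h [ch h0 h1 hx hy]] [k [ck k0 k1 kx ky]].
exists (fun u : I * I =>
  if ival u.2 <= 2^-1 then h (u.1, double u.2) else k (u.1, double1 u.2)); split.
- apply: pasting.
  + by apply: cts_comp; [exact: cts_snd|exact: ival_continuous].
  + apply: cts_comp ch; apply: cts_pair; first exact: cts_fst.
    by apply: cts_comp; [exact: cts_snd|exact: double_continuous].
  + apply: cts_comp ck; apply: cts_pair; first exact: cts_fst.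
    by apply: cts_comp; [exact: cts_snd|exact: double1_continuous].
  + by move=> u u2; rewrite double_half// double1_half// hy kx.
- by move=> t /=; rewrite /mk_path /concat_fun; case: ifP; rewrite ?h0 ?k0.
- by move=> t /=; rewrite /mk_path /concat_fun; case: ifP; rewrite ?h1 ?k1.
- by move=> s; rewrite half_le0 double_zero.
- by move=> s; rewrite half_le1 double1_one.
Qed.

Lemma homotopic_reverse x y (a a' : {path I from x to y}) :
  homotopic a a' -> homotopic (reverse a) (reverse a').
Proof.
move=> [h [ch h0 h1 hx hy]]; exists (fun u => h (u.1, rev_fun u.2)); split.
- apply: cts_comp ch; apply: cts_pair; first exact: cts_fst.
    by apply: cts_comp; [exact: cts_snd|exact: rev_continuous].
- by move=> t; rewrite h0.
- by move=> t; rewrite h1.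
- by move=> s; rewrite rev0.
- by move=> s; rewrite rev1.
Qed.

(* A path extended to the whole line, constantly outside [0, 1]. *)
Let extend x y (a : {path I from x to y}) (t : R) : X := a (clamp t).

Let extend_continuous x y (a : {path I from x to y}) :
  continuous (extend a).
Proof.
exact: cts_comp (@clamp_continuous R) (@cts_fun _ _ a).
Qed.

Let extendE x y (a : {path I from x to y}) t : a t = extend a (ival t).
Proof. by rewrite /extend ivalK. Qed.

Let extend_concat x y z (a : {path I from x to y}) (b : {path I from y to z})
    (t : R) : 0 <= t <= 1 -> extend (concat a b) t =
  if t <= 2^-1 then extend a (2 * t) else extend b (2 * t - 1).
Proof. by move=> t01; rewrite /extend /= /mk_path /concat_fun clampK. Qed.

Lemma homotopic_concatA w x y z (a : {path I from w to x})
    (b : {path I from x to y}) (c : {path I from y to z}) :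
  homotopic (concat (concat a b) c) (concat a (concat b c)).
Proof.
pose f (t : I) : R := Num.min (2 * ival t)
  (Num.min (ival t + 4^-1) (2^-1 * (ival t + 1))).
apply: (@homotopic_reparam _ _ _ _ (extend (concat a (concat b c))) f (@ival R)).
- exact: extend_continuous.
- apply: cts_min; first exact: cts_M (@cts_cst _ _ _) (@ival_continuous R).
  apply: cts_min; first exact: cts_D (@ival_continuous R) (@cts_cst _ _ _).
  apply: cts_M; first exact: cts_cst.
  exact: cts_D (@ival_continuous R) (@cts_cst _ _ _).
- exact: ival_continuous.
- by rewrite /f ival0 mulr0; apply/min_idPl; rewrite le_min; apply/andP; split; lra.
- rewrite /f ival1; apply/eqP; rewrite eq_le; apply/andP; split.
    by rewrite !ge_min; apply/orP; right; apply/orP; right; lra.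
  by rewrite !le_min; apply/and3P; split; lra.
- move=> t; rewrite extendE; have t0 := ival_ge0 t; have t1 := ival_le1 t.
  have f01 : 0 <= f t <= 1.
    rewrite /f !le_min !ge_min; apply/andP; split; first by apply/and3P; split; lra.
    by apply/orP; right; apply/orP; right; lra.
  rewrite (extend_concat (concat a b) c) ?t0 ?t1//.
  rewrite (extend_concat a (concat b c))//.
  have [t2|t2] := leP (ival t) 2^-1.
    rewrite (extend_concat a b); last by apply/andP; split; lra.
    have [t4|t4] := leP (2 * ival t) 2^-1.
      have -> : f t = 2 * ival t.
        by apply/min_idPl; rewrite le_min; apply/andP; split; lra.
      by rewrite t4.
    have -> : f t = ival t + 4^-1.
      rewrite /f (_ : Num.min (ival t + 4^-1) _ = ival t + 4^-1).
        by apply/min_idPr; lra.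
      by apply/min_idPl; lra.
    rewrite ifF; last by apply/negbTE; rewrite -ltNge; lra.
    rewrite (extend_concat b c); last by apply/andP; split; lra.
    rewrite ifT; last by lra.
    by congr extend; field.
  have -> : f t = 2^-1 * (ival t + 1).
    rewrite /f (_ : Num.min (ival t + 4^-1) _ = 2^-1 * (ival t + 1)).
      by apply/min_idPr; lra.
    by apply/min_idPr; lra.
  rewrite ifF; last by apply/negbTE; rewrite -ltNge; lra.
  rewrite (extend_concat b c); last by apply/andP; split; lra.
  rewrite ifF; last by apply/negbTE; rewrite -ltNge; lra.
  by congr extend; field.
- by move=> t; exact: extendE.
Qed.

Lemma homotopic_concat1l x y (a : {path I from x to y}) :
  homotopic (concat (const_path x) a) a.
Proof.
apply: (@homotopic_reparam _ _ _ _ (extend a) (fun t => ival (double1 t)) (@ival R)).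
- exact: extend_continuous.
- exact: cts_comp double1_continuous (@ival_continuous R).
- exact: ival_continuous.
- by congr ival; rewrite /double1 ival0 mulr0 sub0r zeroE clamp0// oppr_le0 ler01.
- by rewrite double1_one.
- move=> t; rewrite /extend ivalK /= /mk_path /concat_fun.
  case: leP => // t2; rewrite /double1 (@clamp0 _ (2 * ival t - 1)); last by lra.
  by rewrite -zeroE path_zero.
- by move=> t; exact: extendE.
Qed.

Lemma homotopic_concat1r x y (a : {path I from x to y}) :
  homotopic (concat a (const_path y)) a.
Proof.
apply: (@homotopic_reparam _ _ _ _ (extend a) (fun t => ival (double t)) (@ival R)).
- exact: extend_continuous.
- exact: cts_comp double_continuous (@ival_continuous R).
- exact: ival_continuous.
- by rewrite double_zero.
- by congr ival; rewrite /double ival1 mulr1 oneE clamp1// ler1n.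
- move=> t; rewrite /extend ivalK /= /mk_path /concat_fun.
  case: leP => // t2; rewrite /double (@clamp1 _ (2 * ival t)); last by lra.
  by rewrite -oneE path_one.
- by move=> t; exact: extendE.
Qed.

Lemma homotopic_concatV x y (a : {path I from x to y}) :
  homotopic (concat a (reverse a)) (const_path x).
Proof.
pose f (t : I) : R := Num.min (2 * ival t) (2 - 2 * ival t).
apply: (@homotopic_reparam _ _ _ _ (extend a) f (fun=> 0)).
- exact: extend_continuous.
- apply: cts_min; first exact: cts_M (@cts_cst _ _ _) (@ival_continuous R).
  apply: cts_B; first exact: cts_cst.
  exact: cts_M (@cts_cst _ _ _) (@ival_continuous R).
- exact: cts_cst.
- by rewrite /f ival0 mulr0; apply/min_idPl; lra.
- by rewrite /f ival1 mulr1 subrr; apply/min_idPr; lra.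
- move=> t; rewrite /extend /= /mk_path /concat_fun.
  have t0 := ival_ge0 t; have t1 := ival_le1 t; case: leP => t2.
    by rewrite /f (min_idPl _)//; lra.
  rewrite /reverse /= /mk_path /reverse_fun clampK; last by apply/andP; split; lra.
  rewrite /f (min_idPr _); last by lra.
  by congr (a (clamp _)); ring.
- by move=> t; rewrite /extend -zeroE path_zero.
Qed.

Lemma reverseK x y (a : {path I from x to y}) : reverse (reverse a) = a.
Proof.
apply/path_eqP => t.
have -> : reverse (reverse a) t = a (clamp (1 - ival (clamp (1 - ival t)))) by [].
have t0 := ival_ge0 t; have t1 := ival_le1 t.
rewrite clampK; last by apply/andP; split; lra.
by rewrite subKr ivalK.
Qed.

Lemma homotopic_concatVl x y (a : {path I from x to y}) :
  homotopic (concat (reverse a) a) (const_path y).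
Proof. by have := homotopic_concatV (reverse a); rewrite reverseK. Qed.

Let homotopicb x y (a b : {path I from x to y}) : bool := `[< homotopic a b >].

Let homotopicb_refl x y : reflexive (@homotopicb x y).
Proof. by move=> a; apply/asboolP; exact: homotopic_refl. Qed.

Let homotopicb_sym x y : symmetric (@homotopicb x y).
Proof. by move=> a b; apply/asboolP/asboolP; exact: homotopic_sym. Qed.

Let homotopicb_trans x y : transitive (@homotopicb x y).
Proof.
by move=> b a c /asboolP ab /asboolP bc; apply/asboolP; exact: homotopic_trans bc.
Qed.

Definition homotopic_equiv x y :=
  EquivRel (@homotopicb x y) (@homotopicb_refl x y) (@homotopicb_sym x y)
    (@homotopicb_trans x y).

Definition groupoid_hom x y : Type := {eq_quot (homotopic_equiv x y)}.

HB.instance Definition _ x y := EqQuotient.on (groupoid_hom x y).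
HB.instance Definition _ x y := Choice.on (groupoid_hom x y).

Definition path_class x y (a : {path I from x to y}) : groupoid_hom x y :=
  \pi_(groupoid_hom x y)%qT a.

Lemma path_classP x y (a b : {path I from x to y}) :
  path_class a = path_class b <-> homotopic a b.
Proof.
split=> [/eqmodP/asboolP//|ab].
by apply/eqmodP/asboolP.
Qed.

Lemma path_class_ind x y (P : groupoid_hom x y -> Prop) :
  (forall a, P (path_class a)) -> forall u, P u.
Proof. by move=> Pc u; rewrite -[u]reprK; exact: Pc. Qed.

Lemma repr_path_class x y (a : {path I from x to y}) :
  homotopic (repr (path_class a)) a.
Proof. by apply/path_classP; rewrite /path_class reprK. Qed.

(* [b][a] = [a * b] *)
Definition groupoid_comp x y z (v : groupoid_hom y z) (u : groupoid_hom x y) :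
  groupoid_hom x z := path_class (concat (repr u) (repr v)).

Definition groupoid_id x : groupoid_hom x x := path_class (const_path x).

Definition groupoid_inv x y (u : groupoid_hom x y) : groupoid_hom y x :=
  path_class (reverse (repr u)).

Lemma groupoid_compE x y z (a : {path I from x to y}) (b : {path I from y to z}) :
  groupoid_comp (path_class b) (path_class a) = path_class (concat a b).
Proof. by apply/path_classP/homotopic_concat; exact: repr_path_class. Qed.

Lemma groupoid_invE x y (a : {path I from x to y}) :
  groupoid_inv (path_class a) = path_class (reverse a).
Proof. by apply/path_classP/homotopic_reverse; exact: repr_path_class. Qed.

Lemma groupoid_compA w x y z (c : groupoid_hom y z) (b : groupoid_hom x y)
    (a : groupoid_hom w x) :
  groupoid_comp c (groupoid_comp b a) = groupoid_comp (groupoid_comp c b) a.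
Proof.
elim/path_class_ind: a => a; elim/path_class_ind: b => b.
elim/path_class_ind: c => c; rewrite !groupoid_compE.
exact/path_classP/homotopic_concatA.
Qed.

Lemma groupoid_comp1l x y (u : groupoid_hom x y) :
  groupoid_comp (groupoid_id y) u = u.
Proof.
elim/path_class_ind: u => a; rewrite groupoid_compE.
exact/path_classP/homotopic_concat1r.
Qed.

Lemma groupoid_comp1r x y (u : groupoid_hom x y) :
  groupoid_comp u (groupoid_id x) = u.
Proof.
elim/path_class_ind: u => a; rewrite groupoid_compE.
exact/path_classP/homotopic_concat1l.
Qed.

Lemma groupoid_compVl x y (u : groupoid_hom x y) :
  groupoid_comp (groupoid_inv u) u = groupoid_id x.
Proof.
elim/path_class_ind: u => a; rewrite groupoid_invE groupoid_compE.
exact/path_classP/homotopic_concatV.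
Qed.

Lemma groupoid_compVr x y (u : groupoid_hom x y) :
  groupoid_comp u (groupoid_inv u) = groupoid_id y.
Proof.
elim/path_class_ind: u => a; rewrite groupoid_invE groupoid_compE.
exact/path_classP/homotopic_concatVl.
Qed.

Definition pi1 x : Type := groupoid_hom x x.

HB.instance Definition _ x := Choice.on (pi1 x).
HB.instance Definition _ x := isGroup.Build (pi1 x)
  (@groupoid_compA x x x x) (@groupoid_comp1l x x) (@groupoid_comp1r x x)
  (@groupoid_compVl x x) (@groupoid_compVr x x).

Lemma pi1_mulE x (a b : {path I from x to x}) :
  ((path_class b : pi1 x) * path_class a)%g = path_class (concat a b).
Proof. exact: groupoid_compE. Qed.

End Homotopy.

Arguments pi1 R {X} x.

Section InducedMap.
Context (R : realType) (E X : topologicalType) (f : continuousType E X).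
Context (e : E) (x : X) (fe : f e = x).
Local Notation I := (unitI R).

Section Loop.
Context (a : {path I from e to e}).

Let map_continuous : continuous (f \o a).
Proof. exact: cts_fun. Qed.

Let map_zero : (f \o a) zero = x.
Proof. by rewrite /= path_zero. Qed.

Let map_one : (f \o a) one = x.
Proof. by rewrite /= path_one. Qed.

Definition map_loop : {path I from x to x} :=
  mk_path map_continuous map_zero map_one.

End Loop.

Definition pi1_map (u : pi1 R e) : pi1 R x := path_class (map_loop (repr u)).

Lemma pi1_mapE (a : {path I from e to e}) :
  pi1_map (path_class a) = path_class (map_loop a).
Proof.
apply/path_classP; have [h [ch h0 h1 hx hy]] := repr_path_class a.
exists (f \o h); split.
- by move=> u; apply: continuous_comp; [exact: ch|exact: cts_fun].
- by move=> t; rewrite /= h0.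
- by move=> t; rewrite /= h1.
- by move=> s; rewrite /= hx.
- by move=> s; rewrite /= hy.
Qed.

Lemma pi1_mapM (u v : pi1 R e) : pi1_map (u * v)%g = (pi1_map u * pi1_map v)%g.
Proof.
elim/path_class_ind: u => a; elim/path_class_ind: v => b.
rewrite pi1_mulE !pi1_mapE pi1_mulE; congr path_class.
apply/path_eqP => t; rewrite /map_loop /concat /= /mk_path /concat_fun /=.
by case: ifP.
Qed.

End InducedMap.

Arguments pi1_map R {E X f e x} fe u.

Definition normal_subgroup (G : groupType) (N : set G) : Prop :=
  [/\ N 1%g, (forall u v, N u -> N v -> N (u * v)%g),
      (forall u, N u -> N u^-1%g) & (forall u v, N u -> N (v^-1 * u * v)%g)].

Definition homeo_on (E X : topologicalType) (p : E -> X) (V : set E) (U : set X) :=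
  [/\ set_bij V U p, {within V, continuous p} &
      exists q : X -> E, {within U, continuous q} /\ forall e, V e -> q (p e) = e].

(* S is the set of sheets over U. *)
Definition evenly_covered (E X : topologicalType) (p : E -> X) (U : set X) :=
  exists S : set (set E), [/\ S `<=` open, trivIset S id,
    \bigcup_(V in S) V = p @^-1` U & forall V, S V -> homeo_on p V U].

Definition covering_map (E X : topologicalType) (p : E -> X) : Prop :=
  [/\ continuous p, (forall x, exists e, p e = x) &
      forall x, exists U : set X, [/\ open U, U x & evenly_covered p U]].

Definition regular_covering (R : realType) (E X : topologicalType)
    (p : continuousType E X) : Prop :=
  covering_map p /\
  forall e : E, normal_subgroup (range (pi1_map R (erefl (p e)))).

(* Main.v *)
From HB Require Import structures.
Require Import Defs.
From mathcomp Require Import all_boot all_order all_algebra generic_quotient.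
From mathcomp Require Import all_classical all_reals topology normedtype.
From mathcomp Require Import homotopy.
From mathcomp Require Import ring lra.
Import Order.TTheory GRing.Theory Num.Theory.
Import numFieldNormedType.Exports.
Set SsrOldRewriteGoalsOrder.
Set Implicit Arguments.
Unset Strict Implicit.
Unset Printing Implicit Defensive.
Local Open Scope classical_set_scope.
Local Open Scope ring_scope.

(** Write Phi for a functor from the fundamental groupoid of X to a group G.  A
relation x <= y of the specialization preorder gives a path from x to y that
stays at x before time 1 and jumps to y at time 1; composing its class with Phi
gives a functor F from X to G.  The whole proof is a study of the comma space
of such an F, for the following Phi: fix a class gamma_x of paths from x0 to
each point x, take G = pi_1(X, x0) / H, and send the class u of a path from x
to y to the coset of gamma_y^-1 u gamma_x.

The relation between paths and the preorder is a cone argument: U_z contracts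
to z through maps that jump, so a path from x to y inside U_z, followed by the
path of y <= z, is homotopic to the path of x <= z (spec_hom_cone).  This makes
F a functor.  It also shows that for a path c and s close to t, the value of Phi
on c restricted to [s, t] is F(c s <= c t) (near_holonomy), because continuity
puts c([s, t]) inside U_(c t).

This local description is exactly the order relation of the comma space, so it
replaces the subdivision of paths that path lifting requires in general.  Given
a path c in X, the formula t |-> (c t, g * Phi(c on [0, t])^-1) is continuous,
hence an explicit lift (lift).  Conversely, for a path t |-> (c t, g t) in the
comma space, the function t |-> g t * Phi(c on [0, t]) is locally constant on
the connected real line, so Phi is trivial on projections of loops
(comma_loop_holonomy).  Together these show that, at every base point, the
image of the fundamental group of the comma space is the kernel of Phi
(range_pi1_comma).

Kernels are normal, and the kernel at x0 is H since H is normal.  As X is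
path-connected and Phi is onto on pi_1(X, x0), every point of the comma space is
joined to (x0, 1) by a lift (connected_comma).  Finally the projection of the
comma space of any functor is a covering, the sheets over U_x being the minimal
open sets U_(x, g) (covering_map_comma). *)

(** * Specialization preorder and continuity *)

Lemma connected_locally_constant (T : topologicalType) (S : Type) (k : T -> S) :
  connected [set: T] -> (forall t, \forall s \near t, k s = k t) ->
  forall s t, k s = k t.
Proof.
move=> cT lk s t; suff fibT : [set u | k u = k t] = [set: T].
  by have : [set u | k u = k t] s by rewrite fibT.
have fiber_open (Q : set S) : open [set u | Q (k u)].
  rewrite openE => u Qu; apply: filterS (lk u) => v /= -> //.
apply: cT; first by exists t.
- by exists [set u | k u = k t]; [exact: (fiber_open [set k t])|rewrite setTI].
- exists [set u | k u = k t]; last by rewrite setTI.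
  by rewrite -openC; exact: (fiber_open (~` [set k t])).
Qed.

Lemma near_lower_space (d : Order.disp_t) (P : preorderType d)
  (x : lower_space P) : \forall y \near x, (y <= x :> P)%O.
Proof.
apply: open_nbhs_nbhs; split; last exact: lexx.
by rewrite open_lowerE => y z yz /(le_trans yz).
Qed.

Lemma cvg_lower_space (T : topologicalType) (d : Order.disp_t)
    (P : preorderType d) (f : T -> lower_space P) (t : T) :
  (\forall s \near t, (f s <= f t :> P)%O) -> f s @[s --> t] --> f t.
Proof.
move=> ft V Vt; have [U [oU Ut] UV] : exists2 U, open_nbhs (f t) U & U `<=` V.
  by move: Vt; rewrite nbhsE.
by apply: filterS ft => s st; apply: UV; rewrite open_lowerE in oU; exact: oU Ut.
Qed.

Section Specialization.
Context (X : topologicalType).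
Implicit Types x y z : spec X.

Lemma open_min_open x : alexandroff X -> open (min_open (x : X)).
Proof. by move=> aX; apply: aX => U []. Qed.

Lemma near_le x : alexandroff X -> \forall y \near (x : X), (y <= x :> spec X)%O.
Proof.
move=> aX; apply: (@filterS _ _ _ (min_open (x : X))).
  by move=> y xy; apply/spec_leP.
by apply: open_nbhs_nbhs; split; [exact: open_min_open|apply/spec_leP].
Qed.

(** Since every neighbourhood of z contains all points below z, a map with values
below z stays continuous when it is redefined as z on a closed set.  This is the
source of all the paths and homotopies that jump. *)
Lemma collapse_continuous (T : topologicalType) (h : T -> X) (p : pred T) z :
  continuous h -> closed [set t | p t] -> (forall t, (h t <= z :> spec X)%O) ->
  continuous (fun t => if p t then z : X else h t).
Proof.
move=> ch cp hz; apply/continuousP => V oV.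
have [Vz|nVz] := pselect (V z).
  have -> : (fun t => if p t then z : X else h t) @^-1` V = setT.
    apply/seteqP; split=> // t _ /=; case: (p t) => //.
    by have /spec_leP := hz t; apply.
  exact: openT.
have -> : (fun t => if p t then z : X else h t) @^-1` V =
    h @^-1` V `&` ~` [set t | p t].
  apply/seteqP; split=> t /=; first by case: (p t).
  by case=> ? /negP/negbTE ->.
apply: openI; last exact: closed_openC.
by move/continuousP: ch; apply.
Qed.

End Specialization.

(** * Paths given by the specialization preorder *)

Section SpecializationPath.
Context (R : realType) (X : topologicalType).
Local Notation I := (unitI R).
Implicit Types x y z : spec X.

Let at_end (t : I) : bool := ival t == 1.

Let closed_at_end : closed [set t | at_end t].
Proof.
have -> : [set t | at_end t] = @ival R @^-1` [set 1].
  by apply/seteqP; split=> t /= /eqP.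
by apply: closed_comp (@closed_eq _ _) => t _; exact: ival_continuous.
Qed.

Section Path.
Context (x y : spec X) (xy : (x <= y)%O).

Let spec_path_fun (t : I) : X := if ival t == 1 then y else x.

Let spec_path_continuous : continuous spec_path_fun.
Proof.
apply: (@collapse_continuous X I (fun=> x) at_end) => //.
exact: cst_continuous.
Qed.

Let spec_path_zero : spec_path_fun zero = x.
Proof. by rewrite /spec_path_fun ival0 eq_sym oner_eq0. Qed.

Let spec_path_one : spec_path_fun one = y.
Proof. by rewrite /spec_path_fun ival1 eqxx. Qed.

Definition spec_path : {path I from (x : X) to (y : X)} :=
  mk_path spec_path_continuous spec_path_zero spec_path_one.

Definition spec_hom : groupoid_hom R (x : X) (y : X) := path_class spec_path.

End Path.

Lemma spec_hom_id x (xx : (x <= x)%O) : spec_hom xx = groupoid_id R (x : X).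
Proof.
congr path_class; apply/path_eqP => t.
by rewrite /spec_path /= /mk_path; case: ifP.
Qed.

(** The homotopy first runs along a and then stays at y until it jumps to z at
time 1; shrinking the part of a that is used pulls it back to the path that
stays at x and jumps. *)
Lemma spec_hom_cone x y z (a : {path I from (x : X) to (y : X)})
    (xz : (x <= z)%O) (yz : (y <= z)%O) :
  (forall t, (a t <= z :> spec X)%O) ->
  groupoid_comp (spec_hom yz) (path_class a) = spec_hom xz.
Proof.
move=> az; rewrite groupoid_compE; apply/path_classP.
pose shrink (u : I * I) : I := clamp ((1 - ival u.1) * (2 * ival u.2)).
exists (fun u => if at_end u.2 then z else a (shrink u)); split.
- apply: (@collapse_continuous X _ (a \o shrink) (at_end \o snd)).
  + move=> u; apply: continuous_comp; last exact: cts_fun.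
    apply: continuous_comp; last exact: clamp_continuous.
    have ci1 : {for u, continuous (fun u : I * I => ival u.1)}.
      by apply: continuous_comp; [exact: cvg_fst|exact: ival_continuous].
    have ci2 : {for u, continuous (fun u : I * I => ival u.2)}.
      by apply: continuous_comp; [exact: cvg_snd|exact: ival_continuous].
    by apply: cvgM; [apply: cvgB|apply: cvgM] => //; exact: cvg_cst.
  + rewrite -[X in closed X]/(snd @^-1` [set t | at_end t]).
    by apply: closed_comp closed_at_end => u _; exact: cvg_snd.
  + by move=> u; exact: az.
- move=> t; rewrite /concat /= /mk_path /concat_fun /shrink /= ival0 subr0 mul1r.
  rewrite /spec_path /= /mk_path.
  have t1 := ival_le1 t; have t0 := ival_ge0 t; rewrite /at_end.
  have [t2|t2] := leP.
    by rewrite ifF//; apply/negbTE/eqP; lra.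
  rewrite clampK; last by apply/andP; split; lra.
  have -> : (2 * ival t - 1 == 1) = (ival t == 1) by apply/eqP/eqP; lra.
  case: ifP => // _; rewrite clamp1 ?path_one //; lra.
- move=> t; rewrite /spec_path /= /mk_path /at_end; case: ifP => // _.
  by rewrite /shrink ival1 subrr mul0r -zeroE path_zero.
- move=> s; rewrite /at_end ival0 eq_sym oner_eq0 /shrink ival0 !mulr0.
  by rewrite -zeroE path_zero.
- by move=> s; rewrite /at_end ival1 eqxx.
Qed.

Lemma spec_hom_comp x y z (xy : (x <= y)%O) (yz : (y <= z)%O)
    (xz : (x <= z)%O) :
  spec_hom xz = groupoid_comp (spec_hom yz) (spec_hom xy).
Proof.
apply/esym/spec_hom_cone => t.
by rewrite /spec_path /= /mk_path; case: ifP.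
Qed.

(** Being joined to x is a locally constant property, because nearby points are
comparable. *)
Lemma connected_path_connected : alexandroff X -> connected [set: X] ->
  forall x y : X, inhabited (groupoid_hom R x y).
Proof.
move=> aX cX x y.
pose k (z : X) := inhabited (groupoid_hom R x z).
suff kE : k y = k x.
  by rewrite -/(k y) kE; exact: inhabits (groupoid_id R x).
apply: connected_locally_constant => // t.
near=> s.
have st : (s <= t :> spec X)%O by near: s; exact: near_le.
apply/propext; split=> -[u].
  exact: inhabits (groupoid_comp (spec_hom st) u).
exact: inhabits (groupoid_comp (groupoid_inv (spec_hom st)) u).
Unshelve. all: by end_near. Qed.

End SpecializationPath.

(** * Segments of paths *)

Section RealValuedMaps.
Context (R : realType) (T : topologicalType) (f g : T -> R).
Hypotheses (cf : continuous f) (cg : continuous g).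

Lemma continuous_addr : continuous (fun t => f t + g t).
Proof. by move=> t; apply: cvgD; [exact: cf|exact: cg]. Qed.

Lemma continuous_subr : continuous (fun t => f t - g t).
Proof. by move=> t; apply: cvgB; [exact: cf|exact: cg]. Qed.

Lemma continuous_mulr : continuous (fun t => f t * g t).
Proof. by move=> t; apply: cvgM; [exact: cf|exact: cg]. Qed.

Lemma continuous_minr : continuous (fun t => Num.min (f t) (g t)).
Proof. by move=> t; apply: continuous_min; [exact: cf|exact: cg]. Qed.

End RealValuedMaps.

Section Segments.
Context (R : realType) (X : topologicalType).
Local Notation I := (unitI R).

(* The map is defined on the whole real line, so that s and t range over it
   freely; the segment runs backwards when t < s. *)
Section Segment.
Context (c : R -> X) (cc : continuous c) (s t : R) (x y : X).
Context (cs : c s = x) (ct : c t = y).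

Let segment_fun (r : I) : X := c (s + ival r * (t - s)).

Let segment_continuous : continuous segment_fun.
Proof.
move=> r; apply: continuous_comp; last exact: cc; move: r.
apply: (@continuous_addr R I); first exact: cst_continuous.
by apply: continuous_mulr; [exact: ival_continuous|exact: cst_continuous].
Qed.

Let segment_zero : segment_fun zero = x.
Proof. by rewrite /segment_fun ival0 mul0r addr0. Qed.

Let segment_one : segment_fun one = y.
Proof. by rewrite /segment_fun ival1 mul1r addrC subrK. Qed.

Definition segment : {path I from x to y} :=
  mk_path segment_continuous segment_zero segment_one.

End Segment.

Section SegmentTheory.
Context (c : R -> X) (cc : continuous c).

Lemma segment_concat (s t u : R) (x y z : X)
    (cs : c s = x) (ct : c t = y) (cu : c u = z) :
  groupoid_comp (path_class (segment cc ct cu)) (path_class (segment cc cs ct)) =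
  path_class (segment cc cs cu).
Proof.
rewrite groupoid_compE; apply/path_classP.
(* The concatenation runs at double speed on [s, t], then on [t, u]; m r and
   2 r - m r are the fractions of each part that are covered at time r. *)
pose m (r : I) : R := Num.min 1 (2 * ival r).
have cm : continuous m.
  apply: (@continuous_minr R I); first exact: cst_continuous.
  by apply: (@continuous_mulr R I);
    [exact: cst_continuous|exact: ival_continuous].
apply: (@homotopic_reparam R X x z _ _ c
  (fun r => s + m r * (t - s) + (2 * ival r - m r) * (u - t))
  (fun r => s + ival r * (u - s))) => //.
- apply: continuous_addr; first apply: continuous_addr.
  + exact: cst_continuous.
  + by apply: continuous_mulr; [exact: cm|exact: cst_continuous].
  apply: continuous_mulr; last exact: cst_continuous.
  apply: continuous_subr; last exact: cm.
  by apply: continuous_mulr; [exact: cst_continuous|exact: ival_continuous].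
- apply: continuous_addr; first exact: cst_continuous.
  by apply: continuous_mulr; [exact: ival_continuous|exact: cst_continuous].
- rewrite /m ival0 mulr0 (min_idPr _) ?ler01//; ring.
- rewrite /m ival1 mulr1 (min_idPl _) ?ler1n//; ring.
- move=> r; have r0 := ival_ge0 r; have r1 := ival_le1 r.
  rewrite /concat /= /mk_path /concat_fun /segment /= /mk_path /m.
  case: leP => r2; (rewrite clampK; last by apply/andP; split; lra).
  + by rewrite (min_idPr _); [congr c; ring|lra].
  + by rewrite (min_idPl _); [congr c; ring|lra].
Qed.

Lemma segment_id (s : R) (x : X) (cs : c s = x) :
  path_class (segment cc cs cs) = groupoid_id R x.
Proof.
congr path_class; apply/path_eqP => r.
by rewrite /segment /= /mk_path subrr mulr0 addr0.
Qed.

(** Near t the map takes values in U_(c t), and a segment inside U_(c t) ending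
at its top element is a cone. *)
Lemma near_segment (t : R) : alexandroff X ->
  \forall s \near t, exists st : (c s <= c t :> spec X)%O,
    path_class (segment cc (erefl (c s)) (erefl (c t))) = spec_hom R st.
Proof.
move=> aX; have [e /= e0 ce] : nbhs t [set s | (c s <= c t :> spec X)%O].
  exact: (cc (near_le (c t : spec X) aX)).
exists e => //= s ste.
have st : (c s <= c t :> spec X)%O by exact: ce.
(* Composing with the identity, seen as the path of c t <= c t, gives a cone. *)
exists st; rewrite -[LHS]groupoid_comp1l -(spec_hom_id R (lexx (c t : spec X))).
apply: spec_hom_cone => r; apply: ce; rewrite /ball_ /=.
have r0 := ival_ge0 r; have r1 := ival_le1 r.
rewrite (_ : t - (s + ival r * (t - s)) = (1 - ival r) * (t - s)); last by ring.
rewrite normrM ger0_norm; last by lra.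
apply: le_lt_trans ste; rewrite -[leRHS]mul1r ler_wpM2r //; lra.
Qed.

End SegmentTheory.

Section Extension.
Context (x y : X) (a : {path I from x to y}).

Definition extend (t : R) : X := a (clamp t).

Lemma extend_continuous : continuous extend.
Proof.
by move=> t; apply: continuous_comp; [exact: clamp_continuous|exact: cts_fun].
Qed.

Lemma extend0 : extend 0 = x. Proof. exact: path_zero. Qed.

Lemma extend1 : extend 1 = y. Proof. exact: path_one. Qed.

Lemma segment_extend : segment extend_continuous extend0 extend1 = a.
Proof.
apply/path_eqP => r.
by rewrite /segment /= /mk_path subr0 mulr1 add0r /extend ivalK.
Qed.

End Extension.

End Segments.

(** * The comma space of a functor on the fundamental groupoid *)

Section Holonomy.
Context (R : realType) (X : topologicalType) (aX : alexandroff X).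
Local Notation I := (unitI R).
Context (G : groupType) (Phi : forall x y : X, groupoid_hom R x y -> G).
Hypothesis Phi_id : forall x, Phi (groupoid_id R x) = 1%g.
Hypothesis Phi_comp : forall x y z (v : groupoid_hom R y z)
  (u : groupoid_hom R x y), Phi (groupoid_comp v u) = (Phi v * Phi u)%g.

Lemma holonomy_functor_id (x : spec X) (xx : (x <= x)%O) :
  Phi (spec_hom R xx) = 1%g.
Proof. by rewrite spec_hom_id Phi_id. Qed.

Lemma holonomy_functor_comp (x y z : spec X) (xy : (x <= y)%O) (yz : (y <= z)%O)
    (xz : (x <= z)%O) :
  Phi (spec_hom R xz) = (Phi (spec_hom R yz) * Phi (spec_hom R xy))%g.
Proof. by rewrite (spec_hom_comp R xy yz) Phi_comp. Qed.

Definition holonomy_functor : group_functor (spec X) G :=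
  @GroupFunctor _ (spec X) G (fun x y xy => Phi (spec_hom R xy))
    holonomy_functor_id holonomy_functor_comp.

Local Notation F := holonomy_functor.
Local Notation E := (lower_space (comma F)).

Section Along.
Context (c : R -> X) (cc : continuous c).

Definition holonomy (s t : R) : G :=
  Phi (path_class (segment cc (erefl (c s)) (erefl (c t)))).

Lemma holonomy_segment (s t : R) (x y : X) (cs : c s = x) (ct : c t = y) :
  Phi (path_class (segment cc cs ct)) = holonomy s t.
Proof. by case: y / ct; case: x / cs. Qed.

Lemma holonomyM (s t u : R) : (holonomy t u * holonomy s t)%g = holonomy s u.
Proof. by rewrite -Phi_comp segment_concat. Qed.

Lemma holonomy_id (s : R) : holonomy s s = 1%g.
Proof. by rewrite /holonomy segment_id Phi_id. Qed.

(** The holonomy of a short segment depends only on its end points: this is the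
fact that turns topology into the order of the comma space. *)
Lemma near_holonomy (t : R) :
  \forall s \near t, exists st : (c s <= c t :> spec X)%O, holonomy s t = F _ _ st.
Proof.
apply: filterS (near_segment cc t aX) => s [st sE].
by exists st; rewrite /holonomy sE.
Qed.

End Along.

Lemma holonomy_extend (x y : X) (a : {path I from x to y}) :
  Phi (path_class a) = holonomy (@extend_continuous R X x y a) 0 1.
Proof. by rewrite -[in LHS](segment_extend a) holonomy_segment. Qed.

(** Along a path in the comma space, the group component times the holonomy of
the projection up to time t is locally constant; a loop has the same group
component at both ends, so its projection has trivial holonomy. *)
Lemma comma_loop_holonomy (e : E) (x : X) (ex : comma_proj F e = x)
    (u : pi1 R e) : Phi (pi1_map R ex u) = 1%g.
Proof.
elim/path_class_ind: u => a; rewrite pi1_mapE holonomy_extend.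
pose cc := @extend_continuous R X x x (map_loop ex a); rewrite -/cc.
pose k (t : R) : G := ((a (clamp t)).2 * holonomy cc 0 t)%g.
suff k01 : k 1 = k 0.
  move: k01; rewrite /k holonomy_id mulg1 -zeroE -oneE path_zero path_one.
  by rewrite -[RHS]mulg1 => /mulgI.
apply: connected_locally_constant => [|t].
  by apply/connected_intervalP => ? ? ? ? ?.
have near_le_a : \forall s \near t, (extend a s <= extend a t :> comma F)%O.
  have ca : continuous (extend a) := @extend_continuous R _ _ _ a.
  exact: (ca t _ (near_lower_space (extend a t))).
apply: filterS2 near_le_a (near_holonomy cc t) => s /comma_leP[st' ast] [st holst].
rewrite /k -[extend a s]/(a (clamp s)) in ast *.
rewrite ast -mulgA -(holonomyM cc 0 s t) holst.
congr (_ * (_ * _))%g; congr farrow; exact: bool_irrelevance.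
Qed.

(* The group component of the lift is forced by the invariance of its product
   with the holonomy up to time t. *)
Section Lift.
Context (x y : X) (a : {path I from x to y}) (g : G).

Let cc := @extend_continuous R X x y a.

Let lift_fun (t : R) : E := (extend a t, (g / holonomy cc 0 t)%g).

Let lift_continuous : continuous lift_fun.
Proof.
move=> t; apply: cvg_lower_space.
apply: filterS (near_holonomy cc t) => s [st holst]; apply/comma_leP; exists st.
transitivity ((g / holonomy cc 0 t) * holonomy cc s t)%g; last by rewrite holst.
by rewrite /= -(holonomyM cc 0 s t) invgM mulgA mulgVK.
Qed.

Let lift_path_continuous : continuous (lift_fun \o @ival R).
Proof.
move=> t; apply: continuous_comp; last exact: lift_continuous.
exact: ival_continuous.
Qed.

Let lift_path_zero : (lift_fun \o @ival R) zero = (x, g).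
Proof. by rewrite /lift_fun /= ival0 extend0 holonomy_id divg1. Qed.

Let lift_path_one :
  (lift_fun \o @ival R) one = (y, (g / Phi (path_class a))%g).
Proof. by rewrite /lift_fun /= ival1 extend1 holonomy_extend. Qed.

Definition lift :
    {path I from ((x, g) : E) to ((y, (g / Phi (path_class a))%g) : E)} :=
  mk_path lift_path_continuous lift_path_zero lift_path_one.

Lemma lift_proj (t : I) : comma_proj F (lift t) = a t.
Proof. by rewrite /lift /= /mk_path /comma_proj /= /extend ivalK. Qed.

End Lift.

(** A loop with trivial holonomy lifts to a loop, and the projection of a loop
has trivial holonomy. *)
Lemma range_pi1_comma (e : E) (x : X) (ex : comma_proj F e = x) :
  range (pi1_map R ex) = [set u : pi1 R x | Phi u = 1%g].
Proof.
apply/seteqP; split=> [_ [v _ <-] /=|u /=]; first exact: comma_loop_holonomy.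
elim/path_class_ind: u => a a1; case: e ex => x' g xx.
case: x / xx a a1 => a a1.
have [b bE] : exists b : {path I from ((x', g) : E) to ((x', g) : E)},
    forall t, comma_proj F (b t) = a t.
  move: (lift a g) (lift_proj a g); rewrite a1 divg1 => b bE; by exists b.
exists (path_class b) => //; rewrite pi1_mapE; congr path_class.
by apply/path_eqP => t; exact: bE.
Qed.

(** The lift starting at (x0, 1) of a path with class u ends with the group
component Phi(u)^-1; correcting a path from x0 to x by a loop at x0 adjusts this
component at will. *)
Lemma connected_comma (x0 : X) : (forall x, inhabited (groupoid_hom R x0 x)) ->
  (forall g, exists u : pi1 R x0, Phi u = g) -> connected [set: E].
Proof.
move=> X0 PhiT; pose e0 : E := (x0, 1%g).
suff pathE (e : E) : inhabited {path I from e0 to e}.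
  suff <- : connected_component [set: E] e0 = [set: E].
    exact: component_connected.
  apply/seteqP; split=> // e _; have [a] := pathE e.
  exists (range (extend a)); last by exists 1 => //; exact: extend1.
  split=> //; first by exists 0 => //; exact: extend0.
  apply: connected_continuous_connected.
    by apply/connected_intervalP => ? ? ? ? ?.
  by apply: continuous_subspaceT; exact: extend_continuous.
case: e => x g; have [v] := X0 x; have [w wE] := PhiT (g * Phi v)^-1%g.
have := lift (repr (groupoid_comp v w)) 1%g.
rewrite -/(path_class _) /path_class reprK Phi_comp wE.
rewrite div1g invgM invgK mulgK => a; exact: inhabits a.
Qed.

End Holonomy.

(** * The covering map *)

(** A point of the minimal open set of (x, g) is determined by its projection
y <= x, its group component being g * F(y <= x). *)
Lemma homeo_on_comma_sheet (X : topologicalType) (G : groupType)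
    (F : group_functor (spec X) G) (x : spec X) (g : G) : alexandroff X ->
  homeo_on (comma_proj F) [set e | (e <= (x, g) :> comma F)%O] (min_open (x : X)).
Proof.
move=> aX.
have [q qE] : exists q : X -> lower_space (comma F),
    forall y (yx : ((y : spec X) <= x)%O), q y = (y, (g * F _ _ yx)%g).
  exists (fun y : X => if pselect ((y : spec X) <= x)%O is left yx
    then (y, (g * F _ _ yx)%g) else (y, g)) => y yx.
  by case: pselect => // yx'; rewrite (bool_irrelevance yx' yx).
have qK e : (e <= (x, g) :> comma F)%O -> q (comma_proj F e) = e.
  case: e => y h /comma_leP[yx hE].
  by rewrite [comma_proj F _]/= (qE _ yx) -hE.
split.
- split.
  + by move=> e /comma_leP[yx _]; exact/spec_leP.
  + by move=> e e' /set_mem/qK {2}<- /set_mem/qK {2}<- ->.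
  + move=> y /spec_leP yx; exists (q y); last by rewrite (qE _ yx).
    by rewrite (qE _ yx); apply/comma_leP; exists yx.
- by apply: continuous_subspaceT; exact: cts_fun.
- exists q; split; last exact: qK.
  rewrite continuous_open_subspace; last exact: open_min_open.
  move=> y /set_mem /spec_leP yx; apply: cvg_lower_space.
  apply: filterS (near_le y aX) => z zy.
  rewrite (qE _ yx) (qE _ (le_trans zy yx)); apply/comma_leP; exists zy.
  by rewrite /= -mulgA -(farrow_comp F zy yx (le_trans zy yx)).
Qed.

Lemma covering_map_comma (X : topologicalType) (G : groupType)
    (F : group_functor (spec X) G) : alexandroff X ->
  covering_map (comma_proj F).
Proof.
move=> aX; split; first exact: cts_fun.
  by move=> x; exists (x, 1%g).
move=> x; exists (min_open x); split; first exact: open_min_open.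
  by move=> U [].
exists (range (fun g => [set e | (e <= (x, g) :> comma F)%O])); split.
- move=> _ [g _ <-]; rewrite open_lowerE => u v uv; exact: le_trans.
- move=> _ _ [g _ <-] [h _ <-] [e [/comma_leP[ex eg] /comma_leP[ex' eh]]].
  suff -> : g = h by [].
  by move: eg; rewrite eh /= (bool_irrelevance ex' ex) => /mulIg.
- apply/seteqP; split=> [e [_ [g _ <-] /comma_leP[yx _]]|[y h] yx].
    exact/spec_leP.
  have {}yx : ((y : spec X) <= x)%O by exact/spec_leP.
  pose g := (h / F _ _ yx)%g.
  exists [set e | (e <= (x, g) :> comma F)%O]; first by exists g.
  by apply/comma_leP; exists yx; rewrite /= mulgVK.
- by move=> _ [g _ <-]; exact: homeo_on_comma_sheet.
Qed.

(** * Quotient groups *)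

Section QuotientGroup.
Context (gT : groupType) (N : set gT) (nN : normal_subgroup N).

Let coset_rel (u v : gT) : bool := `[< N (u^-1 * v)%g >].

Let coset_rel_refl : reflexive coset_rel.
Proof. by move=> u; apply/asboolP; rewrite mulVg; case: nN. Qed.

Let coset_rel_sym : symmetric coset_rel.
Proof.
have [_ _ NV _] := nN.
by move=> u v; apply/asboolP/asboolP => /NV; rewrite invgM invgK.
Qed.

Let coset_rel_trans : transitive coset_rel.
Proof.
have [_ NM _ _] := nN.
move=> v u w /asboolP uv /asboolP vw; apply/asboolP.
by have := NM _ _ uv vw; rewrite mulgA mulgK.
Qed.

Definition coset_equiv : equiv_rel gT :=
  EquivRel coset_rel coset_rel_refl coset_rel_sym coset_rel_trans.

Definition quotient_group : Type := {eq_quot coset_equiv}%qT.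

HB.instance Definition _ := EqQuotient.on quotient_group.
HB.instance Definition _ := Choice.on quotient_group.

Definition quotient_map (u : gT) : quotient_group := \pi_quotient_group%qT u.

Lemma quotient_map_eq (u v : gT) :
  quotient_map u = quotient_map v <-> N (u^-1 * v)%g.
Proof. by split=> [/eqmodP/asboolP|uv]; [|apply/eqmodP/asboolP]. Qed.

Lemma quotient_map_surj (g : quotient_group) : exists u, quotient_map u = g.
Proof. by exists (repr g); rewrite /quotient_map reprK. Qed.

Let mulq (g h : quotient_group) : quotient_group :=
  quotient_map (repr g * repr h)%g.

Let invq (g : quotient_group) : quotient_group := quotient_map (repr g)^-1%g.

Let repr_quotient_map (u : gT) : N ((repr (quotient_map u))^-1 * u)%g.
Proof. by apply/quotient_map_eq; rewrite /quotient_map reprK. Qed.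

Let mulqE (u v : gT) : mulq (quotient_map u) (quotient_map v) =
  quotient_map (u * v)%g.
Proof.
have [_ NM _ NJ] := nN; apply/quotient_map_eq.
set u' := repr _; set v' := repr _.
(* v^-1 (u'^-1 u) v lies in N by normality. *)
have -> : ((u' * v')^-1 * (u * v) = (v'^-1 * v) * (v^-1 * (u'^-1 * u) * v))%g.
  by rewrite invgM !mulgA mulgK.
by apply: NM; [|apply: NJ]; exact: repr_quotient_map.
Qed.

Let invqE (u : gT) : invq (quotient_map u) = quotient_map u^-1%g.
Proof.
have [_ _ NV NJ] := nN; apply/quotient_map_eq; set u' := repr _.
have -> : (u'^-1^-1 * u^-1 = u'^-1^-1 * (u'^-1 * u)^-1 * u'^-1)%g.
  by rewrite invgM invgK mulgA mulgK.
by apply: NJ; apply: NV; exact: repr_quotient_map.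
Qed.

Let mulqA : associative mulq.
Proof.
move=> g h k; have [u <-] := quotient_map_surj g.
have [v <-] := quotient_map_surj h; have [w <-] := quotient_map_surj k.
by rewrite !mulqE mulgA.
Qed.

Let mul1q : left_id (quotient_map 1%g) mulq.
Proof. by move=> g; have [u <-] := quotient_map_surj g; rewrite mulqE mul1g. Qed.

Let mulq1 : right_id (quotient_map 1%g) mulq.
Proof. by move=> g; have [u <-] := quotient_map_surj g; rewrite mulqE mulg1. Qed.

Let mulVq : left_inverse (quotient_map 1%g) invq mulq.
Proof.
by move=> g; have [u <-] := quotient_map_surj g; rewrite invqE mulqE mulVg.
Qed.

Let mulqV : right_inverse (quotient_map 1%g) invq mulq.
Proof.
by move=> g; have [u <-] := quotient_map_surj g; rewrite invqE mulqE mulgV.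
Qed.

HB.instance Definition _ :=
  isGroup.Build quotient_group mulqA mul1q mulq1 mulVq mulqV.

Lemma quotient_map1 : quotient_map 1%g = 1%g. Proof. by []. Qed.

Lemma quotient_mapM (u v : gT) :
  quotient_map (u * v)%g = (quotient_map u * quotient_map v)%g.
Proof. exact/esym/mulqE. Qed.

Lemma quotient_map_ker (u : gT) : quotient_map u = 1%g <-> N u.
Proof.
have [_ _ NV _] := nN; rewrite -quotient_map1 quotient_map_eq mulg1.
by split=> /NV; rewrite ?invgK.
Qed.

End QuotientGroup.

Lemma normal_subgroup_ker (gT rT : groupType) (f : gT -> rT) :
  (forall u v, f (u * v)%g = (f u * f v)%g) -> normal_subgroup [set u | f u = 1%g].
Proof.
move=> fM; have f1 : f 1%g = 1%g.
  by apply: (mulgI (f 1%g)); rewrite -fM !mulg1.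
have fV u : f u^-1%g = (f u)^-1%g.
  by apply: (mulgI (f u)); rewrite -fM !mulgV.
split=> //= [u v|u|u v].
- by rewrite fM => -> ->; rewrite mulg1.
- by rewrite fV => ->; rewrite invg1.
- by rewrite !fM fV => ->; rewrite mulg1 mulVg.
Qed.

(** * The covering of a normal subgroup *)

Theorem corollary3p17 (R : realType) (X : topologicalType) (x0 : X)
    (H : set (pi1 R x0)) (alexX : alexandroff X) (connX : connected [set: X])
    (nH : normal_subgroup H) :
  exists (G : groupType) (F : group_functor (spec X) G),
    [/\ connected [set: lower_space (comma F)],
        regular_covering R (comma_proj F) &
        forall (e : lower_space (comma F)) (pe : comma_proj F e = x0),
          range (pi1_map R pe) = H].
Proof.
have gammaP (x : X) : exists u : groupoid_hom R x0 x, True.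
  by have [u] := connected_path_connected R alexX connX x0 x; exists u.
pose gamma (x : X) : groupoid_hom R x0 x := projT1 (cid (gammaP x)).
pose transport (x y : X) (u : groupoid_hom R x y) : pi1 R x0 :=
  groupoid_comp (groupoid_inv (gamma y)) (groupoid_comp u (gamma x)).
pose Phi (x y : X) (u : groupoid_hom R x y) : quotient_group nH :=
  quotient_map nH (transport x y u).
have Phi_id (x : X) : Phi x x (groupoid_id R x) = 1%g.
  by rewrite /Phi /transport groupoid_comp1l groupoid_compVl.
have Phi_comp (x y z : X) (v : groupoid_hom R y z) (u : groupoid_hom R x y) :
    Phi x z (groupoid_comp v u) = (Phi y z v * Phi x y u)%g.
  rewrite -quotient_mapM; congr quotient_map; rewrite /transport.
  rewrite -[RHS]groupoid_compA -[in RHS]groupoid_compA.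
  rewrite [X in _ = groupoid_comp _ (groupoid_comp v X)]groupoid_compA.
  rewrite groupoid_compVr.
  by rewrite groupoid_comp1l -groupoid_compA.
have transport0 (u : pi1 R x0) :
    transport x0 x0 u = ((gamma x0 : pi1 R x0)^-1 * u * gamma x0)%g.
  by rewrite -mulgA.
exists (quotient_group nH), (holonomy_functor Phi_id Phi_comp); split.
- apply: (connected_comma alexX (x0 := x0)) => [x|g].
    exact: inhabits (gamma x).
  have [u <-] := quotient_map_surj g.
  exists ((gamma x0 : pi1 R x0) * u * (gamma x0 : pi1 R x0)^-1)%g.
  by rewrite /Phi transport0 -!mulgA mulKg mulVg mulg1.
- split; first exact: covering_map_comma.
  move=> e; rewrite range_pi1_comma //; apply: normal_subgroup_ker.
  exact: Phi_comp.
- move=> e pe; rewrite range_pi1_comma //; apply/seteqP.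
  have [_ _ _ HJ] := nH.
  split=> u /=; rewrite /Phi transport0.
    move=> /quotient_map_ker /(HJ _ (gamma x0 : pi1 R x0)^-1)%g.
    by rewrite invgK -!mulgA mulgV mulg1 mulVKg.
  by move=> Hu; apply/quotient_map_ker; exact: HJ.
Qed.
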